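(* Let $b=d>0$, $a\le0$, $c<0$, and let $(S_{\epsilon,\mu})$ be the Boussinesq-Full dispersion system on $\mathbb R^2$ written in the context. Consider the following global existence result. (G) Assume $\zeta_0\in X^0_\mu(\mathbb R^2)$, $\boldsymbol v_0\in X^0_\mu(\mathbb R^2)$. Then there exists a positive constant $\epsilon_0$ (possibly depending on $\|\zeta_0\|_{X^0_\mu}+\|\boldsymbol v_0\|_{X^0_\mu}$) such that for any $\epsilon\le\epsilon_0$ and $\mu\sim\epsilon$, the system $(S_{\epsilon,\mu})$ with $\zeta|_{t=0}=\zeta_0$, $\boldsymbol v|_{t=0}=\boldsymbol v_0$ has a unique solution $(\zeta,\boldsymbol v)\in C([0,\infty);X^0_\mu(\mathbb R^2)\times X^0_\mu(\mathbb R^2))$, and $$\max_{t\in[0,\infty)}\big(\|\zeta\|_{X^0_\mu}+\|\boldsymbol v\|_{X^0_\mu}\big)\le C\big(\|\zeta_0\|_{X^0_\mu}+\|\boldsymbol v_0\|_{X^0_\mu}\big)$$ with a universal constant $C$. Then (G) is in fact a global existence result for small solutions of $(S_{\epsilon,\mu})$ with $\epsilon\sim\mu\sim1$ (when $b=d>0$, $a\le0$, $c<0$). Namely, one reduces $(S_{\epsilon,\mu})$ to the modified system with $\epsilon=\mu=1$ by the change of variables $$\zeta(t,X)=\epsilon^{-1}\tilde\zeta\big(\sqrt\mu^{\,-1}t,\sqrt\mu^{\,-1}X\big),\qquad \boldsymbol v(t,X)=\epsilon^{-1}\tilde{\boldsymbol v}\big(\sqrt\mu^{\,-1}t,\sqrt\mu^{\,-1}X\big),\qquad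 X=(x,y).$$
   Context: The unknowns are $\zeta=\zeta(t,X)\in\mathbb R$ and $\boldsymbol v=\boldsymbol v(t,X)\in\mathbb R^2$, $X\in\mathbb R^2$. For a function $f$, $f(D)$ denotes the Fourier multiplier $\widehat{f(D)u}(\xi)=f(\xi)\hat u(\xi)$, and $|D|$ has symbol $|\xi|$. The system $(S_{\epsilon,\mu})$ is $$\begin{cases}(1-b\mu\Delta)\partial_t\zeta+\frac1\gamma\nabla\cdot\big((1-\epsilon\zeta)\boldsymbol v\big)-\frac{\sqrt\mu}{\gamma^2}|D|\coth(\sqrt{\mu_2}|D|)\nabla\cdot\boldsymbol v+\frac\mu\gamma\Big(a-\frac1{\gamma^2}\coth^2(\sqrt{\mu_2}|D|)\Big)\Delta\nabla\cdot\boldsymbol v=0,\\ (1-d\mu\Delta)\partial_t\boldsymbol v+(1-\gamma)\nabla\zeta-\frac{\epsilon}{2\gamma}\nabla(|\boldsymbol v|^2)+c\mu(1-\gamma)\Delta\nabla\zeta=0,\end{cases}$$ with given parameters $\gamma\in(0,1)$ and $\mu_2\sim1$. The parameter $\mu_2$ is related to $\mu$ by $\mu_2=\mu/\delta^2$, where $\delta$ is the ratio of the depths of the upper and lower fluid layers; accordingly, in the modified system with $\epsilon=\mu=1$ the argument $\sqrt{\mu_2}|D|$ of $\coth$ is replaced by $\sqrt{\mu_2/\mu}\,|D|=\delta^{-1}|D|$. $X^0_\mu(\mathbb R^2)$ is $H^1(\mathbb R^2)$ with norm $\|u\|_{X^0_\mu}^2=\|u\|_{L^2}^2+\mu\|\nabla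 u\|_{L^2}^2$; a vector belongs to it when each component does. The notation $f\sim g$ means $\frac1Cf\le g\le Cf$ for some constant $C$. *)

(* Defs.v *)
From HB Require Import structures.
From mathcomp Require Import all_boot all_order all_algebra complex.
From mathcomp Require Import all_classical all_reals all_analysis.

Set Implicit Arguments.
Unset Strict Implicit.
Unset Printing Implicit Defensive.

Import Order.TTheory GRing.Theory Num.Theory.
Import numFieldNormedType.Exports.

Local Open Scope classical_set_scope.
Local Open Scope ring_scope.
Local Open Scope complex_scope.

Section Plane.
Context {R : realType}.

Definition plane : Type := (R * R)%type.

Definition leb2 := ((@lebesgue_measure R) \x (@lebesgue_measure R))%E.

Definition dirv (j : 'I_2) : plane := ((j == 0)%:R, (j == 1)%:R).

Definition coord (j : 'I_2) (X : plane) : R := if j == 0 then X.1 else X.2.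

Definition dotp (X Y : plane) : R := X.1 * Y.1 + X.2 * Y.2.

(* The library norm on R * R is the max norm; this is the Euclidean one. *)
Definition enorm (X : plane) : R := Num.sqrt (dotp X X).

Definition partial (j : 'I_2) (f : plane -> R) : plane -> R :=
  fun X => 'D_(dirv j) f X.

Definition cre (f : plane -> R[i]) : plane -> R := fun X => complex.Re (f X).
Definition cim (f : plane -> R[i]) : plane -> R := fun X => complex.Im (f X).

Definition cpartial (j : 'I_2) (f : plane -> R[i]) : plane -> R[i] :=
  fun X => partial j (cre f) X +i* partial j (cim f) X.

Definition rschwartz (f : plane -> R) : Prop :=
  forall s : seq 'I_2,
    (forall X : plane, differentiable (foldr partial f s) X) /\
    (forall k : nat, exists M : R, forall X : plane,
       (1 + enorm X) ^+ k * `|foldr partial f s X| <= M).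

Definition schwartz (f : plane -> R[i]) : Prop :=
  rschwartz (cre f) /\ rschwartz (cim f).

Definition cint (f : plane -> R[i]) : R[i] :=
  (\int[leb2]_X cre f X)%R +i* (\int[leb2]_X cim f X)%R.

Definition expi (t : R) : R[i] := cos t +i* sin t.

Definition fourier (u : plane -> R[i]) : plane -> R[i] :=
  fun xi => cint (fun X => expi (- dotp X xi) * u X).

Definition inv_fourier (w : plane -> R[i]) : plane -> R[i] :=
  fun X => (((2 * pi) ^+ 2)^-1)%:C * cint (fun xi => expi (dotp X xi) * w xi).

(* A tempered distribution is represented by its values on test functions;
   only the values on Schwartz functions are ever used. *)
Definition distr : Type := (plane -> R[i]) -> R[i].

Definition of_fun (u : plane -> R) : distr :=
  fun phi => cint (fun X => (u X)%:C * phi X).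

Definition dpartial (j : 'I_2) (T : distr) : distr :=
  fun phi => - T (cpartial j phi).

Definition dlap (T : distr) : distr :=
  fun phi => \sum_(j < 2) dpartial j (dpartial j T) phi.

Definition ddiv (V : 'I_2 -> distr) : distr :=
  fun phi => \sum_(j < 2) dpartial j (V j) phi.

(* f(D)T is the distribution whose Fourier transform (T^ phi = T (fourier phi))
   is f T^, i.e. <f(D)T, phi> = <f T^, inv_fourier phi>. *)
Definition fmult (f : plane -> R) (T : distr) : distr :=
  fun phi => T (fourier (fun xi => (f xi)%:C * inv_fourier phi xi)).

Definition tderivable (T : R -> distr) (t : R) : Prop :=
  forall phi, schwartz phi ->
    derivable (fun s => complex.Re (T s phi)) t 1 /\
    derivable (fun s => complex.Im (T s phi)) t 1.

Definition ddt (T : R -> distr) (t : R) : distr :=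
  fun phi => derive1 (fun s => complex.Re (T s phi)) t
          +i* derive1 (fun s => complex.Im (T s phi)) t.

Definition weak_gradient (u : plane -> R) (g : 'I_2 -> plane -> R) : Prop :=
  forall j, g j \in Lfun leb2 2%:E /\
    forall phi, schwartz phi -> of_fun (g j) phi = dpartial j (of_fun u) phi.

Definition H1 (u : plane -> R) : Prop :=
  u \in Lfun leb2 2%:E /\ exists g, weak_gradient u g.

Definition H1v (v : plane -> plane) : Prop := forall j, H1 (coord j \o v).

Definition L2norm (u : plane -> R) : R := fine ('N[leb2]_2%:E[EFin \o u]).

(* The weak gradient is unique up to a null set, so for u in H^1 the infimum
   below is over a one-element set. *)
Definition Xnorm (mu : R) (u : plane -> R) : R :=
  inf [set Num.sqrt (L2norm u ^+ 2 + mu * \sum_(j < 2) L2norm (g j) ^+ 2)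
      | g in [set g | weak_gradient u g]].

Definition Xnormv (mu : R) (v : plane -> plane) : R :=
  Num.sqrt (\sum_(j < 2) Xnorm mu (coord j \o v) ^+ 2).

Definition coth (x : R) : R :=
  (expR x + expR (- x)) / (expR x - expR (- x)).

(* The symbols |xi| coth(k|xi|) and - (a - g^-2 coth^2(k|xi|)) |xi|^2, the
   latter of (a - g^-2 coth^2(k|D|)) Delta as a whole: coth^2(k|D|) alone has a
   symbol that is not locally integrable at the origin. *)
Definition sym_coth (k : R) (xi : plane) : R := enorm xi * coth (k * enorm xi).

Definition sym_coth2 (g a k : R) (xi : plane) : R :=
  - ((a - (g ^+ 2)^-1 * coth (k * enorm xi) ^+ 2) * enorm xi ^+ 2).

(* The system at time t, in the sense of tempered distributions in X. The
   argument of coth is k|D|: (S_{eps,mu}) is the case k = sqrt mu_2, the modified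
   system is the case eps = mu = 1, k = sqrt (mu_2 / mu) = 1 / delta. *)
Definition bfd_system (g a b c d eps mu k : R)
    (zeta : R -> plane -> R) (v : R -> plane -> plane) (t : R) : Prop :=
  let Z := fun s => of_fun (zeta s) in
  let V := fun (j : 'I_2) s => of_fun (coord j \o v s) in
  [/\ tderivable Z t,
      forall j, tderivable (V j) t,
      forall phi, schwartz phi ->
        (ddt Z t phi - (b * mu)%:C * dlap (ddt Z t) phi)
        + (g^-1)%:C *
          ddiv (fun j => of_fun (fun X => (1 - eps * zeta t X) * coord j (v t X))) phi
        - (Num.sqrt mu / g ^+ 2)%:C *
          fmult (sym_coth k) (ddiv (fun j => V j t)) phi
        + (mu / g)%:C *
          fmult (sym_coth2 g a k) (ddiv (fun j => V j t)) phi = 0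
    & forall (j : 'I_2) phi, schwartz phi ->
        (ddt (V j) t phi - (d * mu)%:C * dlap (ddt (V j) t) phi)
        + (1 - g)%:C * dpartial j (Z t) phi
        - (eps / (2 * g))%:C *
          dpartial j (of_fun (fun X => enorm (v t X) ^+ 2)) phi
        + (c * mu * (1 - g))%:C * dlap (dpartial j (Z t)) phi = 0].

Definition continuous_X (mu : R) (zeta : R -> plane -> R)
    (v : R -> plane -> plane) : Prop :=
  forall t : R, 0 <= t ->
    ((fun s => Xnorm mu (fun X => zeta s X - zeta t X)
             + Xnormv mu (fun X => v s X - v t X))
      @ within [set s : R | 0 <= s] (nbhs t) --> (0 : R)).

Definition global_solution (g a b c d eps mu k : R)
    (z0 : plane -> R) (v0 : plane -> plane)
    (zeta : R -> plane -> R) (v : R -> plane -> plane) : Prop :=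
  [/\ forall t, 0 <= t -> H1 (zeta t) /\ H1v (v t),
      continuous_X mu zeta v,
      forall t, 0 < t -> bfd_system g a b c d eps mu k zeta v t
    & {ae leb2, forall X, zeta 0 X = z0 X /\ v 0 X = v0 X}].

Definition globally_wellposed (g a b c d eps mu k C : R)
    (z0 : plane -> R) (v0 : plane -> plane) : Prop :=
  (exists zeta v,
     global_solution g a b c d eps mu k z0 v0 zeta v /\
     forall t, 0 <= t ->
       Xnorm mu (zeta t) + Xnormv mu (v t) <= C * (Xnorm mu z0 + Xnormv mu v0)) /\
  (forall zeta v zeta' v',
     global_solution g a b c d eps mu k z0 v0 zeta v ->
     global_solution g a b c d eps mu k z0 v0 zeta' v' ->
     forall t, 0 <= t ->
       {ae leb2, forall X, zeta t X = zeta' t X /\ v t X = v' t X}).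

Definition sim (K f h : R) : Prop := f / K <= h <= K * f.

(* The threshold eps0 depends on the data only through a bound N
   on their X^0_mu norm (and on the constant K of mu ~ eps, mu_2 ~ 1). *)
Definition large_data_global_existence (g a b c d : R) : Prop :=
  exists2 C, 0 < C & forall K N, 1 <= K -> 0 < N ->
  exists2 eps0, 0 < eps0 & forall eps mu mu2,
    0 < eps <= eps0 -> sim K eps mu -> sim K 1 mu2 ->
    forall z0 v0, H1 z0 -> H1v v0 -> Xnorm mu z0 + Xnormv mu v0 <= N ->
    globally_wellposed g a b c d eps mu (Num.sqrt mu2) C z0 v0.

(* Small solutions for eps ~ mu ~ 1 and mu_2 = mu / delta^2. In
   large_data_global_existence, mu ~ eps and mu_2 ~ 1 mean delta ~ sqrt eps, and
   passing to eps = mu = 1 divides the norm by sqrt mu / eps ~ 1 / sqrt eps, so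
   data of bounded size there become data of size at most eta, eta ~ delta small. *)
Definition small_data_global_existence (g a b c d : R) : Prop :=
  exists2 C, 0 < C & forall K, 1 <= K ->
  exists2 eta0, 0 < eta0 & forall eta delta eps mu,
    0 < eta <= eta0 -> sim K eta delta -> sim K 1 eps -> sim K 1 mu ->
    forall z0 v0, H1 z0 -> H1v v0 -> Xnorm mu z0 + Xnormv mu v0 <= eta ->
    globally_wellposed g a b c d eps mu (Num.sqrt (mu / delta ^+ 2)) C z0 v0.

Definition modified_small_data_global_existence (g a b c d : R) : Prop :=
  exists2 C, 0 < C & forall K, 1 <= K ->
  exists2 eta0, 0 < eta0 & forall eta delta,
    0 < eta <= eta0 -> sim K eta delta ->
    forall z0 v0, H1 z0 -> H1v v0 -> Xnorm 1 z0 + Xnormv 1 v0 <= eta ->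
    globally_wellposed g a b c d 1 1 delta^-1 C z0 v0.

Definition modified_uniform_small_data_global_existence (g a b c d : R) : Prop :=
  exists C eta0 delta0, [/\ 0 < C, 0 < eta0, 0 < delta0 &
    forall delta, 0 < delta <= delta0 ->
    forall z0 v0, H1 z0 -> H1v v0 -> Xnorm 1 z0 + Xnormv 1 v0 <= eta0 ->
    globally_wellposed g a b c d 1 1 delta^-1 C z0 v0].

Definition rescale_data (W : lmodType R) (eps mu : R) (w : plane -> W)
    : plane -> W :=
  fun X => eps^-1 *: w ((Num.sqrt mu)^-1 *: X).

Definition rescale (W : lmodType R) (eps mu : R) (w : R -> plane -> W)
    : R -> plane -> W :=
  fun t => rescale_data eps mu (w ((Num.sqrt mu)^-1 * t)).

End Plane.

(* Main.v *)
Require Import Defs.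
From HB Require Import structures.
From mathcomp Require Import all_boot all_order all_algebra complex ring lra.
From mathcomp Require Import all_classical all_reals all_analysis measurable_realfun.

Set Implicit Arguments.
Unset Strict Implicit.
Unset Printing Implicit Defensive.

Import Order.TTheory GRing.Theory Num.Theory.
Import numFieldNormedType.Exports.
Local Open Scope ring_scope.

(** The change of variables multiplies every term of the system, tested against
    phi, by one common factor, and replaces phi by the dilate X |-> phi (sqrt mu X),
    so solutions correspond to solutions and, the dimension being 2, the norms are
    multiplied by sqrt mu / eps. Data of size N in the regime mu ~ eps thus become
    data of size about N sqrt eps for the modified system, whose parameter delta is
    itself of order sqrt eps; the equivalences amount to adjusting thresholds.
    Distributions act here on arbitrary functions, so the identities are needed
    without regularity: the change of variables in a Lebesgue integral
    holds for nonmeasurable functions, and directional derivatives scale also where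
    they do not exist, both sides being then 0. *)

(** * Lebesgue measure and integrals under dilations of the plane *)

Section MeasureScaling.
Context {R : realType}.
Local Notation plane := (@plane R).
Local Notation leb2 := (@leb2 R).
Implicit Types (l c : R) (X : plane).
Local Open Scope classical_set_scope.

Definition dil l : plane -> plane := fun X => l *: X.

Lemma dil1E l X : (dil l X).1 = l * X.1. Proof. by []. Qed.
Lemma dil2E l X : (dil l X).2 = l * X.2. Proof. by []. Qed.

Lemma dilK l : l != 0 -> cancel (dil l) (dil l^-1).
Proof. by move=> l0 X; rewrite /dil scalerA mulVf// scale1r. Qed.

Lemma dilVK l : l != 0 -> cancel (dil l^-1) (dil l).
Proof. by move=> l0 X; rewrite /dil scalerA mulfV// scale1r. Qed.

Local Notation mR := (measurableTypeR R).

Lemma measurable_scale l : measurable_fun [set: mR] ( *%R l : mR -> mR).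
Proof. exact: mulrl_measurable. Qed.

Lemma measurable_dil l : measurable_fun [set: mR * mR] (dil l : mR * mR -> mR * mR).
Proof.
apply/measurable_fun_pairP; split.
  exact: measurableT_comp (measurable_scale l) measurable_fst.
exact: measurableT_comp (measurable_scale l) measurable_snd.
Qed.

(** A multiple of a pushforward is obtained here as a bundled measure, the form to which the
    uniqueness theorems for Lebesgue and product measures apply. *)
Lemma scaled_pushforward d (T : measurableType d) (mu : {measure set T -> \bar R})
    (f : T -> T) (r : R) : measurable_fun [set: T] f -> 0 <= r ->
  exists m : {measure set T -> \bar R}, forall A, m A = (r%:E * mu (f @^-1` A))%E.
Proof.
move=> mf r0.
by exists (mscale (NngNum r0)
  (measure_function_pushforward__canonical__measure_function_Measure mu mf)).
Qed.

(** [l] times the pushforward of Lebesgue measure gives each interval []u, w]] its length, so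
    uniqueness identifies it with Lebesgue measure. *)
Lemma lebesgue_measure_scale l (A : set mR) : 0 < l -> measurable A ->
  (lebesgue_measure ( *%R l @^-1` A : set mR) = l^-1%:E * lebesgue_measure A)%E.
Proof.
move=> l0 mA.
have [m mE] := scaled_pushforward (@lebesgue_measure R) (measurable_scale l) (ltW l0).
have -> : lebesgue_measure A = m A.
  apply: lebesgue_measure_unique => // _ [[u w] _ <-].
  rewrite mE (_ : _ @^-1` _ =
      [set` Interval (BRight (u / l : R)) (BRight (w / l : R))]); last first.
    by apply/seteqP; split => x /=; rewrite !in_itv /= ltr_pdivrMr// ler_pdivlMr// ![x * l]mulrC.
  rewrite [X in (_ * X)%E](lebesgue_measure_itv (Interval (BRight (u / l)) (BRight (w / l)))).
  rewrite lebesgue_measure_itv /= !lte_fin ltr_pM2r ?invr_gt0//.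
  case: ifPn => _; last by rewrite mule0.
  by rewrite -!EFinB -EFinM -mulrBl mulrCA mulfV ?gt_eqF// mulr1.
by rewrite mE muleA -EFinM mulVf ?gt_eqF// mul1e.
Qed.

(** The preimage of a rectangle is a rectangle, so [l ^+ 2] times the pushforward agrees with the
    product measure on rectangles, hence everywhere. *)
Lemma leb2_dil l (A : set (mR * mR)) : 0 < l -> measurable A ->
  (leb2 (dil l @^-1` A) = (l^-1 ^+ 2)%:E * leb2 A)%E.
Proof.
move=> l0 mA.
have [m mE] := scaled_pushforward leb2 (measurable_dil l) (sqr_ge0 l).
have -> : leb2 A = m A.
  apply: product_measure_unique => // B D mB mD.
  rewrite mE.
  have -> : (dil l : mR * mR -> mR * mR) @^-1` (B `*` D)
     = ( *%R l @^-1` B) `*` ( *%R l @^-1` D) by apply/seteqP; split.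
  have ms (E : set mR) : measurable E -> measurable ( *%R l @^-1` E : set mR).
    by move=> mE'; rewrite -[X in measurable X]setTI; exact: measurable_scale.
  rewrite [X in (_ * X)%E](product_measure1E _ _ (ms _ mB) (ms _ mD)).
  rewrite [X in (_ * (X * _))%E](lebesgue_measure_scale l0 mB).
  rewrite [X in (_ * (_ * X))%E](lebesgue_measure_scale l0 mD).
  rewrite muleACA [LHS]muleA [X in (X * _)%E = _](_ : _ = 1%E) ?mul1e//.
  transitivity ((l ^+ 2 * (l^-1 * l^-1))%:E) => //.
  by rewrite -expr2 -exprMn mulfV ?gt_eqF// expr1n.
by rewrite mE muleA -EFinM -exprMn mulVf ?gt_eqF// expr1n mul1e.
Qed.

Import HBNNSimple.

Lemma nnsfun_dil c l (h : {nnsfun mR * mR >-> R}) : 0 <= c ->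
  exists h' : {nnsfun mR * mR >-> R}, forall X, h' X = c * h (dil l X).
Proof.
move=> c0; pose g X : R := c * h (dil l X).
have mg : measurable_fun setT (g : mR * mR -> R).
  apply: measurable_funM => //.
  exact: measurableT_comp (measurable_dil l).
have fg : finite_set (range g).
  apply: (@sub_finite_set _ _ (( *%R c) @` range h)).
    by move=> _ [X _ <-]; exists (h (dil l X)) => //; exists (dil l X).
  exact/finite_image/fimfunP.
have g0 X : 0 <= g X by rewrite mulr_ge0.
pose h' := HB.pack_for {nnsfun mR * mR >-> R} (g : mR * mR -> R)
  (@isMeasurableFun.Build _ _ (mR * mR)%type R g mg)
  (@FiniteImage.Build (mR * mR)%type R g fg)
  (@isNonNegFun.Build (mR * mR)%type R g g0).
by exists h'.
Qed.

(** Simple functions are measurable, so the pushforward formula applies, and by [leb2_dil] the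
    pushforward of [leb2] is [l^-1 ^+ 2] times [leb2]. *)
Lemma integral_nnsfun_dil c l (h h' : {nnsfun mR * mR >-> R}) : 0 <= c -> 0 < l ->
  (forall X, h' X = c * h (dil l X)) ->
  (\int[leb2]_X (h' X)%:E = (c * l^-1 ^+ 2)%:E * \int[leb2]_X (h X)%:E)%E.
Proof.
move=> c0 l0 h'E.
under eq_integral do rewrite h'E EFinM.
rewrite ge0_integralZl//=; last 2 first.
- by apply/measurable_EFinP; exact: measurableT_comp (measurable_dil l).
- by move=> X _; rewrite lee_fin.
rewrite EFinM -muleA; congr (_ * _)%E.
have mh : measurable_fun setT (EFin \o h) by exact/measurable_EFinP.
have := ge0_integral_pushforward (measurable_dil l) leb2 measurableT mh.
rewrite preimage_setT => <-; last by move=> X _; rewrite lee_fin.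
pose nl := NngNum (sqr_ge0 l^-1).
rewrite (eq_measure_integral (mscale nl leb2)); first last.
- by move=> ? A mA _; exact: leb2_dil.
- exact: measurable_dil.
by apply: (ge0_integral_mscale leb2 measurableT nl mh) => X _; rewrite lee_fin.
Qed.

(* The integral of a nonnegative function, measurable or not: the changes of
   variables below need no measurability. *)
Let lower (f : plane -> \bar R) : \bar R :=
  ereal_sup [set sintegral leb2 h |
    h in [set h : {nnsfun mR * mR >-> R} | forall X, ((h X)%:E <= f X)%E]].

(** Dilating and scaling a simple function below [f] gives one below the transformed function;
    taking the supremum yields this half of the equality. *)
Let lower_dil_ge c l f : 0 < c -> 0 < l ->
  ((c * l^-1 ^+ 2)%:E * lower f <= lower (fun X => c%:E * f (dil l X)))%E.
Proof.
move=> c0 l0; have k0 : 0 < c * l^-1 ^+ 2 by rewrite mulr_gt0// exprn_gt0// invr_gt0.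
rewrite -lee_pdivlMl//; apply: ge_ereal_sup => _ [h /= hf <-].
rewrite lee_pdivlMl//; apply: ereal_sup_ubound.
have [h' h'E] := nnsfun_dil l h (ltW c0).
exists h' => [X /=|]; first by rewrite h'E EFinM lee_pmul2l// hf.
by rewrite -!integralT_nnsfun; exact: integral_nnsfun_dil (ltW c0) l0 h'E.
Qed.

(** The other half is [lower_dil_ge] for the transformed function with the inverse factors [c^-1]
    and [l^-1]. *)
Let lower_dil c l f : 0 < c -> 0 < l ->
  lower (fun X => c%:E * f (dil l X))%E = ((c * l^-1 ^+ 2)%:E * lower f)%E.
Proof.
move=> c0 l0; apply/eqP; rewrite eq_le lower_dil_ge// andbT.
have k0 : 0 < c * l^-1 ^+ 2 by rewrite mulr_gt0// exprn_gt0// invr_gt0.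
have fE : (fun X => c^-1%:E * (c%:E * f (dil l (dil l^-1 X))))%E = f.
  by apply/funext => X; rewrite muleA -EFinM mulVf ?gt_eqF// mul1e dilVK ?gt_eqF.
have := lower_dil_ge (fun X => c%:E * f (dil l X))%E (c := c^-1) (l := l^-1).
rewrite !invr_gt0 fE => /(_ c0 l0).
rewrite (_ : c * _ = (c^-1 * l^-1^-1 ^+ 2)^-1); last by rewrite invfM !invrK exprVn.
by rewrite lee_pdivlMl// mulr_gt0 ?invr_gt0// invrK exprn_gt0.
Qed.

Lemma integral_dil c l (f : plane -> \bar R) : 0 < c -> 0 < l ->
  (\int[leb2]_X (c%:E * f (dil l X)) = (c * l^-1 ^+ 2)%:E * \int[leb2]_X f X)%E.
Proof.
move=> c0 l0; have k0 : 0 < c * l^-1 ^+ 2 by rewrite mulr_gt0// exprn_gt0// invr_gt0.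
pose g X := f (dil l X).
have pos : ((fun X => c%:E * f (dil l X))^\+ = fun X => c%:E * f^\+ (dil l X))%E.
  by rewrite (ge0_funeposM g (ltW c0)); apply/funext => X; rewrite !funeposE.
have neg : ((fun X => c%:E * f (dil l X))^\- = fun X => c%:E * f^\- (dil l X))%E.
  by rewrite (ge0_funenegM g (ltW c0)); apply/funext => X; rewrite !funenegE.
rewrite /integral !patch_setT pos neg -!/(lower _) !lower_dil//.
move: (lower _) (lower _) => u w.
(* The factor being positive, the difference of the two parts scales even when one or both are
   infinite. *)
case: u w => [u| |] [w| |] //=; rewrite ?gt0_muley ?gt0_muleNy ?lte_fin//.
by congr EFin; rewrite mulrBr.
Qed.

End MeasureScaling.

(** * Directional derivatives under scaling *)

Section Derivatives.
Context {R : realType}.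
Local Open Scope classical_set_scope.

Lemma cvg_dnbhs0_scale (l : R) : l != 0 -> ( *%R l @ 0^') --> (0 : R)^'.
Proof.
move=> l0 A A0.
have cl : ( *%R l @ (0 : R)) --> (0 : R).
  by rewrite -[X in _ --> X](mulr0 l); apply: cvgMr; exact: cvg_id.
have lA : \forall h \near (0 : R), l * h != 0 -> A (l * h) := cl _ A0.
rewrite /dnbhs /within /=; apply: filterS lA => h Ah h0.
by apply: Ah; rewrite mulf_neq0.
Qed.

Context {V : normedModType R}.

(** The quotient at step [h] is [a * l] times the quotient of [f] at step [l * h], and [h |-> l * h]
    respects punctured neighbourhoods of 0. *)
Lemma cvg_derive_scale (f : V -> R) (a l : R) (v X : V) (L : R) : l != 0 ->
  (fun h => h^-1 *: (f (h *: v + l *: X) - f (l *: X))) @ 0^' --> L ->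
  (fun h => h^-1 *: (a * f (l *: (h *: v + X)) - a * f (l *: X))) @ 0^' --> a * l * L.
Proof.
move=> l0 fL.
rewrite (_ : (fun h => _ *: (a * _ - _)) = (fun=> a * l) \*
    ((fun h => h^-1 *: (f (h *: v + l *: X) - f (l *: X))) \o *%R l)); last first.
  apply/funext => h /=; rewrite -mulrBr invfM [l *: (_ + _)]scalerDr [l *: (_ *: _)]scalerA.
  set u := f _; set w := f _; rewrite -![_ *: _ in LHS]/(_ * _) -![_ *: _ in RHS]/(_ * _).
  by rewrite -mulrA [l * _]mulrA [l * _]mulrA mulfV// mul1r mulrCA.
apply: cvgM; first exact: cvg_cst.
exact: (cvg_comp _ _ (cvg_dnbhs0_scale l0) fL).
Qed.

Lemma derive_scale (f : V -> R) (a l : R) (v X : V) : a != 0 -> l != 0 ->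
  (derivable (fun X => a * f (l *: X)) X v <-> derivable f (l *: X) v) /\
  'D_v (fun X => a * f (l *: X)) X = a * l * 'D_v f (l *: X).
Proof.
move=> a0 l0.
have fwd L : (fun h => h^-1 *: (f (h *: v + l *: X) - f (l *: X))) @ 0^' --> L ->
  (fun h => h^-1 *: (a * f (l *: (h *: v + X)) - a * f (l *: X))) @ 0^' --> a * l * L.
  exact: cvg_derive_scale.
(* [f] is recovered from its transform by the factors [a^-1] and [l^-1], so the converse is another
   instance of the same convergence. *)
have bwd L : (fun h => h^-1 *: (a * f (l *: (h *: v + X)) - a * f (l *: X))) @ 0^' --> L ->
    (fun h => h^-1 *: (f (h *: v + l *: X) - f (l *: X))) @ 0^' --> a^-1 * l^-1 * L.
  pose f' Y := a * f (l *: Y).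
  have fE Y : f Y = a^-1 * f' (l^-1 *: Y).
    by rewrite /f' scalerA mulfV// scale1r mulrA mulVf// mul1r.
  have XE : l^-1 *: (l *: X) = X by rewrite scalerA mulVf// scale1r.
  rewrite -/(f' _) -[in X in X -> _]XE => f'L.
  under eq_fun do rewrite !fE.
  by apply: cvg_derive_scale => //; rewrite invr_eq0.
have dvd : derivable (fun X => a * f (l *: X)) X v <-> derivable f (l *: X) v.
  split=> [/cvg_ex[L] /bwd h|/cvg_ex[L] /fwd h]; apply/cvg_ex;
  by [exists (a^-1 * l^-1 * L) | exists (a * l * L)].
split=> //; have [df|ndf] := pselect (derivable f (l *: X) v).
  by apply: cvg_lim => //; exact: fwd.
(* A limit that does not exist takes the default value [point], which is 0 in [R], so both sides
   vanish. *)
have noL (T : Type) (F : set_system T) (g : T -> R) : ~ cvg (g @ F) -> lim (g @ F) = point.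
  by move=> nc; apply: xgetPN => L gL; apply: nc; apply/cvg_ex; exists L.
have p0 : point = 0 :> R by [].
rewrite p0 in noL.
have -> : 'D_v f (l *: X) = 0 by exact: noL.
by rewrite mulr0; apply: noL => /dvd.
Qed.

End Derivatives.

(** * Dilations of Schwartz functions, integrals and Fourier transforms *)

Section Plane.
Context {R : realType}.
Local Notation plane := (@plane R).
Local Notation leb2 := (@leb2 R).
Implicit Types (l c : R) (X : plane) (phi : plane -> R[i]).
Local Open Scope classical_set_scope.
Local Open Scope complex_scope.

Lemma coord_dil (j : 'I_2) l X : Defs.coord j (dil l X) = l * Defs.coord j X.
Proof. by rewrite /Defs.coord; case: ifP. Qed.

Lemma dotp_dil l X Y : dotp (dil l X) Y = l * dotp X Y.
Proof. by rewrite /dotp !dil1E !dil2E; ring. Qed.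

Lemma dotpC X Y : dotp X Y = dotp Y X.
Proof. by rewrite /dotp mulrC [_.2 * _]mulrC. Qed.

Lemma enorm_dil l X : 0 <= l -> enorm (dil l X) = l * enorm X.
Proof.
move=> l0; rewrite /enorm dotp_dil dotpC dotp_dil mulrA -expr2.
by rewrite sqrtrM ?sqr_ge0// sqrtr_sqr ger0_norm.
Qed.

Lemma enorm_ge0 X : 0 <= enorm X. Proof. exact: sqrtr_ge0. Qed.

Lemma partial_dil (j : 'I_2) (a l : R) (f : plane -> R) : a != 0 -> l != 0 ->
  partial j (fun X => a * f (dil l X)) = fun X => a * l * partial j f (dil l X).
Proof.
move=> a0 l0; apply/funext => X.
exact: (derive_scale f (dirv j) X a0 l0).2.
Qed.

Lemma complex_ReZ c (z : R[i]) : complex.Re (c%:C * z) = c * complex.Re z.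
Proof. by case: z => x y /=; rewrite mul0r subr0. Qed.

Lemma complex_ImZ c (z : R[i]) : complex.Im (c%:C * z) = c * complex.Im z.
Proof. by case: z => x y /=; rewrite mul0r addr0. Qed.

Lemma cpartial_dil (j : 'I_2) (a l : R) phi : a != 0 -> l != 0 ->
  cpartial j (fun X => a%:C * phi (dil l X)) =
  fun X => (a * l)%:C * cpartial j phi (dil l X).
Proof.
move=> a0 l0; apply/funext => X; rewrite /cpartial.
have -> : cre (fun X => a%:C * phi (dil l X)) = fun X => a * cre phi (dil l X).
  by apply/funext => Y; rewrite /cre complex_ReZ.
have -> : cim (fun X => a%:C * phi (dil l X)) = fun X => a * cim phi (dil l X).
  by apply/funext => Y; rewrite /cim complex_ImZ.
by rewrite !partial_dil//; apply/eqP; rewrite eq_complex complex_ReZ complex_ImZ !eqxx.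
Qed.

Lemma foldr_partial_dil (s : seq 'I_2) l (f : plane -> R) : l != 0 ->
  foldr partial (f \o dil l) s = fun X => l ^+ size s * foldr partial f s (dil l X).
Proof.
move=> l0; elim: s => [|j s IH] /=.
  by apply/funext => X; rewrite expr0 mul1r.
by rewrite IH partial_dil ?expf_neq0//; apply/funext => X; rewrite exprSr.
Qed.

Lemma rschwartz_dil l (f : plane -> R) : 0 < l -> rschwartz f -> rschwartz (f \o dil l).
Proof.
move=> l0 sf s; have [df bf] := sf s; rewrite foldr_partial_dil ?gt_eqF//.
split=> [X|k].
  apply: differentiableM; first exact: differentiable_cst.
  apply: (differentiable_comp (f := dil l)); last exact: df.
  exact: differentiableZ.
have [M fM] := bf k.
(* The derivatives contribute [l ^+ size s]; the weights are compared by
   [1 + |X| <= (1 + l^-1) (1 + l |X|)]. *)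
exists (l ^+ size s * (1 + l^-1) ^+ k * M) => X.
rewrite normrM (ger0_norm (exprn_ge0 _ (ltW l0))) mulrCA -mulrA.
rewrite ler_wpM2l ?exprn_ge0 ?(ltW l0)//.
have V0 : 0 < l^-1 by rewrite invr_gt0.
apply: le_trans (ler_wpM2l _ (fM (dil l X))); last by rewrite exprn_ge0// addr_ge0 ?ltW.
rewrite mulrA -exprMn; apply: ler_wpM2r => //.
have X0 := enorm_ge0 X.
apply: lerXn2r; rewrite ?nnegrE ?mulr_ge0 ?addr_ge0 ?enorm_ge0 ?(ltW V0)//.
rewrite enorm_dil ?ltW// mulrDl mul1r mulrDr mulr1 mulrA mulVf ?gt_eqF// mul1r.
by have := mulr_ge0 (ltW l0) X0; lra.
Qed.

Lemma schwartz_dil l phi : 0 < l -> schwartz phi -> schwartz (phi \o dil l).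
Proof.
move=> l0 [rphi iphi].
by split; [exact: (rschwartz_dil l0 rphi)|exact: (rschwartz_dil l0 iphi)].
Qed.

Lemma Rintegral_dil c l (f : plane -> R) : 0 < c -> 0 < l ->
  \int[leb2]_X (c * f (dil l X)) = c * l^-1 ^+ 2 * \int[leb2]_X f X.
Proof.
move=> c0 l0; rewrite /Rintegral.
under eq_integral do rewrite EFinM.
rewrite (integral_dil (EFin \o f))//.
rewrite -[X in (_ * X)%E]/(\int[leb2]_X (f X)%:E)%E.
have k0 : 0 < c * l^-1 ^+ 2 by rewrite mulr_gt0// exprn_gt0// invr_gt0.
(* An infinite integral is sent to 0 by [fine], on both sides alike. *)
by case: (\int[leb2]_X (f X)%:E)%E => [u| |] //=; rewrite ?gt0_muley ?gt0_muleNy ?lte_fin//= mulr0.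
Qed.

Lemma cint_dil c l phi : 0 < c -> 0 < l ->
  cint (fun X => c%:C * phi (dil l X)) = (c * l^-1 ^+ 2)%:C * cint phi.
Proof.
move=> c0 l0; apply/eqP; rewrite eq_complex complex_ReZ complex_ImZ /cint /=.
under eq_Rintegral do rewrite /cre complex_ReZ.
under [X in _ && (X == _)]eq_Rintegral do rewrite /cim complex_ImZ.
by rewrite (Rintegral_dil (cre phi))// (Rintegral_dil (cim phi))// !eqxx.
Qed.

Lemma dil1 X : dil 1 X = X. Proof. exact: scale1r. Qed.

Lemma cintZ c phi : 0 < c -> cint (fun X => c%:C * phi X) = c%:C * cint phi.
Proof.
move=> c0; have := cint_dil phi c0 ltr01; rewrite invr1 expr1n mulr1 => <-.
by congr cint; apply/funext => X; rewrite dil1.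
Qed.

Lemma fourierZ c phi : 0 < c ->
  fourier (fun X => c%:C * phi X) = fun xi => c%:C * fourier phi xi.
Proof.
move=> c0; apply/funext => xi; rewrite /fourier -cintZ//.
by congr cint; apply/funext => X; rewrite mulrCA.
Qed.

(** The dilation is moved across the inner product to the integration variable, and the change of
    variables costs the Jacobian. *)
Lemma fourier_dil l phi xi : 0 < l ->
  fourier phi (dil l xi) = (l^-1 ^+ 2)%:C * fourier (phi \o dil l^-1) xi.
Proof.
move=> l0; rewrite /fourier -[X in X%:C]mul1r -cint_dil//.
congr cint; apply/funext => X; rewrite mul1r /= dilK ?gt_eqF//.
by rewrite dotp_dil [dotp X (dil _ _)]dotpC dotp_dil dotpC.
Qed.

Lemma inv_fourier_dil l phi X : 0 < l ->
  inv_fourier phi (dil l X) = (l^-1 ^+ 2)%:C * inv_fourier (phi \o dil l^-1) X.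
Proof.
move=> l0; rewrite /inv_fourier mulrCA; congr (_ * _).
rewrite -[X in X%:C]mul1r -cint_dil//.
congr cint; apply/funext => xi; rewrite mul1r /= dilK ?gt_eqF//.
by rewrite dotp_dil [dotp X (dil _ _)]dotpC dotp_dil [dotp X xi]dotpC.
Qed.

End Plane.

(** * Dilation of distributions and the operators of the system *)

Section Distributions.
Context {R : realType}.
Local Notation plane := (@plane R).
Local Notation leb2 := (@leb2 R).
Local Notation distr := (@distr R).
Implicit Types (c s : R) (X : plane) (phi : plane -> R[i]) (T : distr).
Local Open Scope classical_set_scope.
Local Open Scope complex_scope.

Lemma real_complexM (x y : R) : (x * y)%:C = x%:C * y%:C.
Proof. exact: rmorphM. Qed.

(* Both notions quantify over all functions, not only over Schwartz ones, because
   fmult evaluates a distribution at a function that need not be Schwartz. *)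
Definition pos_homogeneous T : Prop :=
  forall c phi, 0 < c -> T (fun X => c%:C * phi X) = c%:C * T phi.

Definition dilated c s T T' : Prop := forall phi, T' phi = c%:C * T (phi \o dil s).

Lemma of_fun_homogeneous (u : plane -> R) : pos_homogeneous (of_fun u).
Proof.
move=> c phi c0; rewrite /of_fun -cintZ//; congr cint.
by apply/funext => X; rewrite mulrCA.
Qed.

(** The dilation passes to the test function with Jacobian [m], the square of [Num.sqrt m] in
    dimension 2; the amplitude contributes [e^-1]. *)
Lemma dilated_of_fun (e m : R) (u : plane -> R) : 0 < e -> 0 < m ->
  dilated (e^-1 * m) (Num.sqrt m) (of_fun u) (of_fun (rescale_data e m u)).
Proof.
move=> e0 m0 phi; have s0 : 0 < Num.sqrt m by rewrite sqrtr_gt0.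
have mE : m = (Num.sqrt m)^-1^-1 ^+ 2 by rewrite invrK sqr_sqrtr ?ltW.
rewrite [X in (_ * X)%:C]mE /of_fun -cint_dil ?invr_gt0//; congr cint; apply/funext => X /=.
by rewrite dilVK ?gt_eqF// /rescale_data /= real_complexM mulrA.
Qed.

Lemma dpartial_homogeneous (j : 'I_2) T : pos_homogeneous T -> pos_homogeneous (dpartial j T).
Proof.
move=> hT c phi c0; rewrite /dpartial mulrN -hT//; congr (- T _).
have := cpartial_dil j phi (lt0r_neq0 c0) (oner_neq0 R).
rewrite mulr1 => h.
under eq_fun do rewrite -[X in phi X]dil1.
by rewrite h; apply/funext => X; rewrite dil1.
Qed.

(** The chain rule leaves a factor [s^-1] inside the argument of [T]; as [distr] carries no
    linearity, homogeneity is what pulls it out. *)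
Lemma dilated_dpartial (j : 'I_2) c s T T' : 0 < s -> pos_homogeneous T ->
  dilated c s T T' -> dilated (c / s) s (dpartial j T) (dpartial j T').
Proof.
move=> s0 hT TT' phi.
rewrite /dpartial TT' mulrN; apply: (congr1 -%R).
have -> : cpartial j phi \o dil s = fun X => (s^-1)%:C * cpartial j (phi \o dil s) X.
  have := cpartial_dil j phi (oner_neq0 R) (lt0r_neq0 s0).
  rewrite (_ : (fun X => 1%:C * _) = phi \o dil s) => [->|]; last first.
    by apply/funext => X; rewrite mul1r.
  by apply/funext => X /=; rewrite mul1r mulrA -real_complexM mulVf ?gt_eqF// mul1r.
by rewrite hT ?invr_gt0// mulrA -real_complexM.
Qed.

Lemma sum_homogeneous (T_ : 'I_2 -> distr) : (forall j, pos_homogeneous (T_ j)) ->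
  pos_homogeneous (fun phi => \sum_(j < 2) T_ j phi).
Proof. by move=> hT c phi c0; rewrite mulr_sumr; apply: eq_bigr => j _; exact: hT. Qed.

Lemma dilated_sum c s (T_ T_' : 'I_2 -> distr) : (forall j, dilated c s (T_ j) (T_' j)) ->
  dilated c s (fun phi => \sum_(j < 2) T_ j phi) (fun phi => \sum_(j < 2) T_' j phi).
Proof. by move=> h phi; rewrite mulr_sumr; apply: eq_bigr => j _; exact: h. Qed.

Lemma dilated_dlap c s T T' : 0 < s -> pos_homogeneous T ->
  dilated c s T T' -> dilated (c / s / s) s (dlap T) (dlap T').
Proof.
move=> s0 hT TT'; apply: dilated_sum => j.
by do 2?[apply: dilated_dpartial => //; try exact: dpartial_homogeneous].
Qed.

Lemma ddiv_homogeneous (V : 'I_2 -> distr) : (forall j, pos_homogeneous (V j)) ->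
  pos_homogeneous (ddiv V).
Proof. by move=> hV; apply: sum_homogeneous => j; exact: dpartial_homogeneous. Qed.

Lemma dilated_ddiv c s (V V' : 'I_2 -> distr) : 0 < s ->
  (forall j, pos_homogeneous (V j)) -> (forall j, dilated c s (V j) (V' j)) ->
  dilated (c / s) s (ddiv V) (ddiv V').
Proof. by move=> s0 hV VV'; apply: dilated_sum => j; exact: dilated_dpartial. Qed.

(** The Jacobians of the direct and inverse Fourier transforms, [s^-1 ^+ 2] and [s ^+ 2], cancel, so
    only the factor [a] of the symbol remains. *)
Lemma dilated_fmult a c s (f g : plane -> R) T T' : 0 < a -> 0 < s ->
  (forall xi, f (dil s^-1 xi) = a * g xi) -> pos_homogeneous T ->
  dilated c s T T' -> dilated (c * a) s (fmult g T) (fmult f T').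
Proof.
move=> a0 s0 fg hT TT' phi; rewrite /fmult TT' real_complexM -mulrA -[a%:C * _]hT//.
congr (_ * T _); apply/funext => X /=.
have si0 : 0 < s^-1 by rewrite invr_gt0.
have as0 : 0 < a * s ^+ 2 by rewrite mulr_gt0// exprn_gt0.
have fgE : (fun xi => (f xi)%:C * inv_fourier phi xi) \o dil s^-1 =
    fun xi => (a * s ^+ 2)%:C * ((g xi)%:C * inv_fourier (phi \o dil s) xi).
  apply/funext => xi /=; rewrite fg (inv_fourier_dil _ _ si0) !invrK !real_complexM.
  by rewrite mulrACA.
rewrite (fourier_dil _ _ s0) fgE fourierZ// mulrA -real_complexM.
apply: (congr1 (fun x => x%:C * _)).
by rewrite mulrCA -exprMn mulVf ?gt_eqF// expr1n mulr1.
Qed.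

Lemma ddt_homogeneous (T : R -> distr) t : (forall s, pos_homogeneous (T s)) ->
  pos_homogeneous (ddt T t).
Proof.
move=> hT c phi c0; apply/eqP; rewrite eq_complex complex_ReZ complex_ImZ /ddt /=.
under eq_fun do rewrite hT// complex_ReZ.
under [X in _ && (derive1 X _ == _)]eq_fun do rewrite hT// complex_ImZ.
have scale1 (f : R -> R) : derive1 (fun s => c * f s) t = c * derive1 f t.
  rewrite !derive1E -[in RHS](mulr1 c) -[in RHS](scale1r t).
  rewrite -(derive_scale f (1 : R) t (lt0r_neq0 c0) (oner_neq0 R)).2.
  by apply: (congr1 (fun g => 'D_1 g t)); apply/funext => s; rewrite scale1r.
by rewrite !scale1 !eqxx.
Qed.

(** The time dilation contributes [r]. Differentiability is not assumed, since [derive_scale] gives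
    the value in all cases. *)
Lemma dilated_ddt c s r (T T' : R -> distr) t : 0 < c -> 0 < r ->
  (forall u, dilated c s (T (r * u)) (T' u)) ->
  dilated (c * r) s (ddt T (r * t)) (ddt T' t).
Proof.
move=> c0 r0 TT' phi; apply/eqP; rewrite eq_complex complex_ReZ complex_ImZ /ddt /=.
have scale1 (f : R -> R) : derive1 (fun s => c * f (r * s)) t = c * r * derive1 f (r * t).
  rewrite !derive1E.
  exact: (derive_scale f (1 : R) t (lt0r_neq0 c0) (lt0r_neq0 r0)).2.
under eq_fun do rewrite TT' complex_ReZ.
under [X in _ && (derive1 X _ == _)]eq_fun do rewrite TT' complex_ImZ.
by rewrite (scale1 (fun u => complex.Re (T u (phi \o dil s))))
  (scale1 (fun u => complex.Im (T u (phi \o dil s)))) !eqxx.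
Qed.

(** Differentiability is tested on Schwartz functions, a class stable under dilation. *)
Lemma dilated_tderivable c s r (T T' : R -> distr) t : 0 < c -> 0 < s -> 0 < r ->
  (forall u, dilated c s (T (r * u)) (T' u)) ->
  tderivable T (r * t) -> tderivable T' t.
Proof.
move=> c0 s0 r0 TT' dT phi sphi.
have [dre dim] := dT _ (schwartz_dil s0 sphi).
have dscale (f : R -> R) : derivable f (r * t) 1 -> derivable (fun s => c * f (r * s)) t 1.
  exact: (derive_scale f (1 : R) t (lt0r_neq0 c0) (lt0r_neq0 r0)).1.2.
split; under eq_fun do rewrite TT' ?complex_ReZ ?complex_ImZ.
  exact: (dscale (fun u => complex.Re (T u (phi \o dil s)))).
exact: (dscale (fun u => complex.Im (T u (phi \o dil s)))).
Qed.

End Distributions.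

(** * Scaling of the Sobolev spaces and their norms *)

Section Norms.
Context {R : realType}.
Local Notation plane := (@plane R).
Local Notation leb2 := (@leb2 R).
Local Notation mR := (measurableTypeR R).
Implicit Types (e m mu : R) (X : plane) (u : plane -> R).
Local Open Scope classical_set_scope.

Lemma fine_pZl (k : R) (x : \bar R) : 0 < k -> fine (k%:E * x)%E = k * fine x.
Proof.
by move=> k0; case: x => [x| |] //=; rewrite ?gt0_muley ?gt0_muleNy ?lte_fin//= mulr0.
Qed.

Lemma inf_pZl_le (k : R) (A : set R) : 0 < k -> has_lbound A ->
  k * inf A <= inf [set k * x | x in A].
Proof.
(* The infimum of the empty set is 0 by convention, so the bound also covers functions without a
   weak gradient. *)
move=> k0 lA; have [->|/set0P[x Ax]] := eqVneq A set0.
  by rewrite image_set0 inf0 mulr0.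
apply: lb_le_inf; first by exists (k * x); exists x.
by move=> _ [y Ay <-]; rewrite ler_pM2l// ge_inf.
Qed.

Lemma inf_pZl (k : R) (A : set R) : 0 < k -> has_lbound A ->
  inf [set k * x | x in A] = k * inf A.
Proof.
move=> k0 lA; apply/eqP; rewrite eq_le inf_pZl_le// andbT.
have kV0 : 0 < k^-1 by rewrite invr_gt0.
have lkA : has_lbound [set k * x | x in A].
  by case: lA => M AM; exists (k * M) => _ [x Ax <-]; rewrite ler_pM2l// AM.
rewrite -ler_pdivrMl//; apply: le_trans (inf_pZl_le kV0 lkA) _.
rewrite image_comp le_eqVlt; apply/orP; left; apply/eqP; congr inf.
rewrite -[RHS]image_id; apply: eq_imagel => x _ /=.
by rewrite mulrA mulVf ?mul1r ?gt_eqF.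
Qed.

Lemma rescale_dataK (W : lmodType R) e m (w : plane -> W) : 0 < e -> 0 < m ->
  rescale_data e^-1 m^-1 (rescale_data e m w) = w.
Proof.
move=> e0 m0; apply/funext => X; rewrite /rescale_data invrK scalerA mulfV ?gt_eqF//.
by rewrite scale1r scalerA sqrtrV ?ltW// mulfV ?scale1r// invr_eq0 gt_eqF// sqrtr_gt0.
Qed.

Lemma rescale_dataVK (W : lmodType R) e m (w : plane -> W) : 0 < e -> 0 < m ->
  rescale_data e m (rescale_data e^-1 m^-1 w) = w.
Proof.
by move=> e0 m0; have := rescale_dataK w (e := e^-1) (m := m^-1);
   rewrite !invr_gt0 !invrK => ->.
Qed.

Lemma coord_rescale_data (j : 'I_2) e m (w : plane -> plane) :
  Defs.coord j \o rescale_data e m w = rescale_data e m (Defs.coord j \o w).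
Proof. by apply/funext => X; rewrite /rescale_data /= [LHS]coord_dil. Qed.

(** The squared integrand scales by [e^-1 ^+ 2] and the Jacobian is [m]; the square root of the
    product is the factor. *)
Lemma Lnorm2_rescale_data e m u : 0 < e -> 0 < m ->
  ('N[leb2]_2%:E[EFin \o rescale_data e m u] =
   (Num.sqrt m / e)%:E * 'N[leb2]_2%:E[EFin \o u])%E.
Proof.
move=> e0 m0; rewrite unlock; have s0 : 0 < Num.sqrt m by rewrite sqrtr_gt0.
have es0 : 0 < (Num.sqrt m)^-1 by rewrite invr_gt0.
have e20 : 0 < e^-1 ^+ 2 by rewrite exprn_gt0// invr_gt0.
transitivity ((\int[leb2]_X ((e^-1 ^+ 2)%:E *
    (`|(EFin \o u) (dil (Num.sqrt m)^-1 X)| `^ 2))) `^ 2^-1)%E.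
  congr (_ `^ _)%E; apply: eq_integral => X _ /=.
  rewrite -EFinM -[rescale_data e m u X]/(e^-1 * u (dil (Num.sqrt m)^-1 X)); congr EFin.
  rewrite normrM (ger0_norm (ltW _)) ?invr_gt0// powRM ?invr_ge0 ?(ltW e0)//.
  by rewrite powR_mulrn// invr_ge0 ltW.
rewrite (integral_dil (fun X => `|(EFin \o u) X| `^ 2)%E)// invrK.
rewrite poweRM; first last.
- by apply: integral_ge0 => X _; exact: poweR_ge0.
- by rewrite lee_fin mulr_ge0 ?sqr_ge0.
rewrite poweR_EFin powR12_sqrt; last by rewrite mulr_ge0 ?sqr_ge0.
have -> : e^-1 ^+ 2 * Num.sqrt m ^+ 2 = (Num.sqrt m / e) ^+ 2 by rewrite exprMn mulrC.
by rewrite sqrtr_sqr ger0_norm// divr_ge0 ?ltW.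
Qed.

Lemma L2norm_rescale_data e m u : 0 < e -> 0 < m ->
  L2norm (rescale_data e m u) = Num.sqrt m / e * L2norm u.
Proof.
by move=> e0 m0; rewrite /L2norm Lnorm2_rescale_data// fine_pZl// divr_gt0// sqrtr_gt0.
Qed.

Lemma Lfun2_rescale_data e m u : 0 < e -> 0 < m ->
  u \in Lfun leb2 2%:E -> rescale_data e m u \in Lfun leb2 2%:E.
Proof.
move=> e0 m0 /andP[]; rewrite !inE /= => mu fu.
apply/andP; split; rewrite inE /=.
  apply: measurable_funM => //.
  exact: measurableT_comp mu (measurable_dil (Num.sqrt m)^-1).
rewrite /finite_norm Lnorm2_rescale_data// lte_mul_pinfty// lee_fin.
by rewrite divr_ge0 ?sqrtr_ge0 ?ltW.
Qed.

(** Differentiating brings out one more [(Num.sqrt m)^-1], hence the amplitude parameter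
    [e * Num.sqrt m] for the gradient. *)
Lemma weak_gradient_rescale_data e m u g : 0 < e -> 0 < m -> weak_gradient u g ->
  weak_gradient (rescale_data e m u) (fun j => rescale_data (e * Num.sqrt m) m (g j)).
Proof.
move=> e0 m0 ug j; have [Lg gE] := ug j.
have s0 : 0 < Num.sqrt m by rewrite sqrtr_gt0.
have es0 : 0 < e * Num.sqrt m by rewrite mulr_gt0.
split=> [|phi sphi]; first exact: Lfun2_rescale_data.
rewrite (dilated_of_fun _ es0 m0) gE; last exact: schwartz_dil.
rewrite (dilated_dpartial j s0 (@of_fun_homogeneous _ _) (dilated_of_fun u e0 m0)).
by apply: (congr1 (fun x => (x%:C)%C * _)); rewrite invfM mulrAC.
Qed.

Lemma H1_rescale_data e m u : 0 < e -> 0 < m -> H1 (rescale_data e m u) <-> H1 u.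
Proof.
have fwd e' m' w : 0 < e' -> 0 < m' -> H1 w -> H1 (rescale_data e' m' w).
  move=> e0 m0 [Lw [g wg]]; split; first exact: Lfun2_rescale_data.
  by eexists; exact: weak_gradient_rescale_data wg.
move=> e0 m0; split=> [hu|]; last exact: fwd.
by rewrite -(rescale_dataK u e0 m0); apply: fwd hu; rewrite invr_gt0.
Qed.

Lemma H1v_rescale_data e m (w : plane -> plane) : 0 < e -> 0 < m ->
  H1v (rescale_data e m w) <-> H1v w.
Proof.
move=> e0 m0; split=> hw j; have := hw j; rewrite coord_rescale_data.
  by move/(H1_rescale_data _ e0 m0).
by move=> ?; apply/(H1_rescale_data _ e0 m0).
Qed.

(** The weight [mu * m] compensates the extra [(Num.sqrt m)^-1] in the gradient, so both parts of
    the norm scale alike; weak gradients before and after correspond bijectively. *)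
Lemma Xnorm_rescale_data mu e m u : 0 < e -> 0 < m ->
  Xnorm (mu * m) (rescale_data e m u) = Num.sqrt m / e * Xnorm mu u.
Proof.
move=> e0 m0; have s0 : 0 < Num.sqrt m by rewrite sqrtr_gt0.
have k0 : 0 < Num.sqrt m / e by rewrite divr_gt0.
have es0 : 0 < e * Num.sqrt m by rewrite mulr_gt0.
rewrite /Xnorm -inf_pZl//; last by exists 0 => _ [g _ <-]; exact: sqrtr_ge0.
have gE g : Num.sqrt (L2norm (rescale_data e m u) ^+ 2 + mu * m *
      \sum_(j < 2) L2norm (rescale_data (e * Num.sqrt m) m (g j)) ^+ 2) =
    Num.sqrt m / e * Num.sqrt (L2norm u ^+ 2 + mu * \sum_(j < 2) L2norm (g j) ^+ 2).
  rewrite -[X in _ = X * _]ger0_norm ?(ltW k0)// -sqrtr_sqr -sqrtrM ?sqr_ge0//.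
  congr Num.sqrt; rewrite L2norm_rescale_data// exprMn mulrDr; congr (_ + _).
  rewrite !big_ord_recl !big_ord0 !L2norm_rescale_data// -[X in mu * X * _](sqr_sqrtr (ltW m0)).
  by field; rewrite !gt_eqF.
congr inf; apply/seteqP; split=> [_ [g' ug' <-]|_ [_ [g ug <-] <-]] /=.
  (* Any weak gradient of the rescaled function arises by rescaling one of [u], found by the inverse
     change of variables. *)
  pose g j := rescale_data (e * Num.sqrt m)^-1 m^-1 (g' j).
  have gg' j : rescale_data (e * Num.sqrt m) m (g j) = g' j by exact: rescale_dataVK.
  exists (Num.sqrt (L2norm u ^+ 2 + mu * \sum_(j < 2) L2norm (g j) ^+ 2)).
    exists g => //=; rewrite -(rescale_dataK u e0 m0).
    have -> : g = fun j => rescale_data (e^-1 * Num.sqrt m^-1) m^-1 (g' j).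
      by apply/funext => j; rewrite /g invfM sqrtrV// ltW.
    by apply: weak_gradient_rescale_data; rewrite ?invr_gt0.
  by rewrite -gE; under [in LHS]eq_bigr do rewrite gg'.
exists (fun j => rescale_data (e * Num.sqrt m) m (g j)) => //=.
exact: weak_gradient_rescale_data.
Qed.

Lemma Xnormv_rescale_data mu e m (w : plane -> plane) : 0 < e -> 0 < m ->
  Xnormv (mu * m) (rescale_data e m w) = Num.sqrt m / e * Xnormv mu w.
Proof.
move=> e0 m0; have k0 : 0 <= Num.sqrt m / e by rewrite divr_ge0 ?sqrtr_ge0 ?ltW.
rewrite /Xnormv -[X in _ = X * _]ger0_norm// -sqrtr_sqr -sqrtrM ?sqr_ge0//.
rewrite mulr_sumr; congr Num.sqrt; apply: eq_bigr => j _.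
by rewrite coord_rescale_data Xnorm_rescale_data// exprMn.
Qed.

(** Preimages of null sets under a dilation are null, by [leb2_dil]. *)
Lemma ae_dil l (P Q : plane -> Prop) : 0 < l -> (forall X, P (dil l X) -> Q X) ->
  {ae leb2, forall X, P X} -> {ae leb2, forall X, Q X}.
Proof.
move=> l0 PQ [A [mA A0 PA]]; exists (dil l @^-1` A); split.
- by rewrite -[X in measurable X]setTI; exact: measurable_dil.
- by rewrite leb2_dil// A0 mule0.
- by move=> X QX; apply: PA => PX; apply/QX/PQ.
Qed.

End Norms.

(** * Invariance of the system under the change of variables *)

Section System.
Context {R : realType}.
Local Notation plane := (@plane R).
Local Notation leb2 := (@leb2 R).
Implicit Types (e m mu : R) (X : plane) (zeta : R -> plane -> R) (v : R -> plane -> plane).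
Local Open Scope classical_set_scope.
Local Open Scope complex_scope.

(** The argument of [coth] is unchanged, so only the prefactor [enorm xi], of degree 1, scales; in
    [sym_coth2] the prefactor has degree 2. *)
Lemma sym_coth_dil (k s : R) (xi : plane) : 0 < s ->
  sym_coth (k * s) (dil s^-1 xi) = s^-1 * sym_coth k xi.
Proof.
move=> s0; rewrite /sym_coth enorm_dil ?invr_ge0 ?ltW//.
have -> : k * s * (s^-1 * enorm xi) = k * enorm xi by field; rewrite gt_eqF.
exact: esym (mulrA _ _ _).
Qed.

Lemma sym_coth2_dil (g a k s : R) (xi : plane) : 0 < s ->
  sym_coth2 g a (k * s) (dil s^-1 xi) = s^-1 ^+ 2 * sym_coth2 g a k xi.
Proof.
move=> s0; rewrite /sym_coth2 enorm_dil ?invr_ge0 ?ltW//.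
have -> : k * s * (s^-1 * enorm xi) = k * enorm xi by field; rewrite gt_eqF.
by rewrite exprMn; ring.
Qed.

(** Each unknown contributes [e^-1 * s ^+ 2] and each derivative [s^-1]; the coefficients [mu * m]
    and [eps * e] absorb the rest, leaving the common factor [e^-1 * s]. *)
Lemma bfd_system_rescale (g a b c d eps mu k e m : R) zeta v (t : R) :
  0 < g -> 0 < mu -> 0 < e -> 0 < m ->
  bfd_system g a b c d eps mu k zeta v ((Num.sqrt m)^-1 * t) ->
  bfd_system g a b c d (eps * e) (mu * m) (k * Num.sqrt m)
    (rescale e m zeta) (rescale e m v) t.
Proof.
move=> g0 mu0 e0 m0 [dZ dV eqZ eqV]; set s := Num.sqrt m in dZ dV eqZ eqV *.
have s0 : 0 < s by rewrite sqrtr_gt0.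
have sV0 : 0 < s^-1 by rewrite invr_gt0.
have mE : m = s ^+ 2 by rewrite sqr_sqrtr// ltW.
have c0 : 0 < e^-1 * m by rewrite mulr_gt0 ?invr_gt0.
pose Z u := of_fun (zeta u); pose V (j : 'I_2) u := of_fun (Defs.coord j \o v u).
have hV j u : pos_homogeneous (V j u) by exact: of_fun_homogeneous.
have hZ u : pos_homogeneous (Z u) by exact: of_fun_homogeneous.
have sZ u : dilated (e^-1 * m) s (Z (s^-1 * u)) (of_fun (rescale e m zeta u)).
  exact: dilated_of_fun.
have sV j u : dilated (e^-1 * m) s (V j (s^-1 * u)) (of_fun (Defs.coord j \o rescale e m v u)).
  by rewrite coord_rescale_data; exact: dilated_of_fun.
have sdZ := dilated_ddt t c0 sV0 sZ.
have sdV j := dilated_ddt t c0 sV0 (sV j).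
have hdZ := ddt_homogeneous (s^-1 * t) hZ.
have hdV j := ddt_homogeneous (s^-1 * t) (hV j).
have slapZ := dilated_dlap s0 hdZ sdZ.
have slapV j := dilated_dlap s0 (hdV j) (sdV j).
have sdivV := dilated_ddiv s0 (hV^~ (s^-1 * t)) (sV^~ t).
have hdivV := ddiv_homogeneous (hV^~ (s^-1 * t)).
have s20 : 0 < s^-1 ^+ 2 by rewrite exprn_gt0.
(* Used to split the new coefficient times the dilation factor into the common factor and the old
   coefficient. *)
have coef (x y K w : R) (D : R[i]) : x * y = K * w -> x%:C * (y%:C * D) = K%:C * (w%:C * D).
  by move=> xyKw; rewrite !mulrA -!real_complexM xyKw.
split.
- exact: dilated_tderivable sZ dZ.
- by move=> j; exact: dilated_tderivable (sV j) (dV j).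
- move=> phi sphi.
  (* The [e] in [eps * e] cancels the amplitude of [zeta], so the whole flux scales linearly, with
     amplitude [e^-1]. *)
  have sN j : dilated (e^-1 * m) s
      (of_fun (fun X => (1 - eps * zeta (s^-1 * t) X) * Defs.coord j (v (s^-1 * t) X)))
      (of_fun (fun X => (1 - eps * e * rescale e m zeta t X) *
        Defs.coord j (rescale e m v t X))).
    rewrite (_ : (fun X => _ * Defs.coord j (rescale e m v t X)) =
        rescale_data e m (fun X => (1 - eps * zeta (s^-1 * t) X) *
          Defs.coord j (v (s^-1 * t) X))); first exact: dilated_of_fun.
    apply/funext => X; rewrite /rescale /rescale_data -/s [Defs.coord j _]coord_dil.
    rewrite -[(s^-1 *: X)%R]/(dil s^-1 X).
    set z := zeta _ _; set w := Defs.coord j _.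
    rewrite -[e^-1 *: z]/(e^-1 * z) -[RHS]/(e^-1 * ((1 - eps * z) * w)).
    by field; rewrite gt_eqF.
  have eqZphi := eqZ _ (schwartz_dil s0 sphi).
  rewrite (sdZ phi) (slapZ phi).
  rewrite (dilated_ddiv s0 (fun j => @of_fun_homogeneous _ _) sN phi).
  rewrite (dilated_fmult sV0 s0 (fun xi => sym_coth_dil k xi s0) hdivV sdivV phi).
  rewrite (dilated_fmult s20 s0 (fun xi => sym_coth2_dil g a k xi s0) hdivV sdivV phi).
  rewrite sqrtrM ?ltW// -/s mE.
  rewrite (coef (b * (mu * s ^+ 2)) _ (e^-1 * s) (b * mu)); last first.
    by field; rewrite !gt_eqF.
  rewrite (coef g^-1 _ (e^-1 * s) g^-1); last by field; rewrite !gt_eqF.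
  rewrite (coef (Num.sqrt mu * s / g ^+ 2) _ (e^-1 * s) (Num.sqrt mu / g ^+ 2)); last first.
    by field; rewrite !gt_eqF.
  rewrite (coef (mu * s ^+ 2 / g) _ (e^-1 * s) (mu / g)); last first.
    by field; rewrite !gt_eqF.
  rewrite (_ : e^-1 * s ^+ 2 * s^-1 = e^-1 * s); last by field; rewrite !gt_eqF.
  rewrite -mulrBr -mulrDr -mulrBr -mulrDr.
  exact: (eq_trans (congr1 _ eqZphi) (mulr0 _)).
- move=> j phi sphi.
  (* The quadratic term has amplitude [(e ^+ 2)^-1]; the coefficient [eps * e] brings it back to
     [e^-1]. *)
  have e20 : 0 < e ^+ 2 by rewrite exprn_gt0.
  have sN := dilated_of_fun (fun X => enorm (v (s^-1 * t) X) ^+ 2) e20 m0.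
  have NE : (fun X => enorm (rescale e m v t X) ^+ 2) =
      rescale_data (e ^+ 2) m (fun X => enorm (v (s^-1 * t) X) ^+ 2).
    apply/funext => X; rewrite /rescale /rescale_data -/s.
    by rewrite [enorm _]enorm_dil ?invr_ge0 ?ltW// exprMn exprVn.
  have eqVphi := eqV j _ (schwartz_dil s0 sphi).
  rewrite (sdV j phi) (slapV j phi).
  have hdpZ := dpartial_homogeneous j (hZ (s^-1 * t)).
  rewrite (dilated_dlap s0 hdpZ (dilated_dpartial j s0 (hZ _) (sZ t)) phi).
  rewrite (dilated_dpartial j s0 (hZ _) (sZ t) phi).
  rewrite NE (dilated_dpartial j s0 (@of_fun_homogeneous _ _) sN phi).
  rewrite -/s mE.
  rewrite (coef (d * (mu * s ^+ 2)) _ (e^-1 * s) (d * mu)); last first.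
    by field; rewrite !gt_eqF.
  rewrite (coef (1 - g) _ (e^-1 * s) (1 - g)); last by field; rewrite !gt_eqF.
  rewrite (coef (eps * e / (2 * g)) _ (e^-1 * s) (eps / (2 * g))); last first.
    by field; rewrite !gt_eqF.
  rewrite (coef (c * (mu * s ^+ 2) * (1 - g)) _ (e^-1 * s) (c * mu * (1 - g))); last first.
    by field; rewrite !gt_eqF.
  rewrite (_ : e^-1 * s ^+ 2 * s^-1 = e^-1 * s); last by field; rewrite !gt_eqF.
  rewrite -mulrBr -mulrDr -mulrBr -mulrDr.
  exact: (eq_trans (congr1 _ eqVphi) (mulr0 _)).
Qed.

End System.

(** * Correspondence of global solutions and of well-posedness *)

Section Solutions.
Context {R : realType}.
Local Notation plane := (@plane R).
Local Notation leb2 := (@leb2 R).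
Implicit Types (e m mu : R) (X : plane) (zeta : R -> plane -> R) (v : R -> plane -> plane).
Local Open Scope classical_set_scope.

Lemma rescale_dataB (W : lmodType R) e m (w w' : plane -> W) :
  (fun X => rescale_data e m w X - rescale_data e m w' X) =
  rescale_data e m (fun X => w X - w' X).
Proof. by apply/funext => X; rewrite /rescale_data scalerBr. Qed.

Lemma rescaleK (W : lmodType R) e m (w : R -> plane -> W) : 0 < e -> 0 < m ->
  rescale e^-1 m^-1 (rescale e m w) = w.
Proof.
move=> e0 m0; apply/funext => t; rewrite /rescale mulrA sqrtrV ?ltW// mulfV.
  by rewrite mul1r rescale_dataK.
by rewrite invr_eq0 gt_eqF// sqrtr_gt0.
Qed.

Lemma rescaleVK (W : lmodType R) e m (w : R -> plane -> W) : 0 < e -> 0 < m ->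
  rescale e m (rescale e^-1 m^-1 w) = w.
Proof.
by move=> e0 m0; have := rescaleK w (e := e^-1) (m := m^-1);
   rewrite !invr_gt0 !invrK => ->.
Qed.

Lemma rescale_scale (W : lmodType R) e m (w : R -> plane -> W) t : 0 < m ->
  rescale e m w (Num.sqrt m * t) = rescale_data e m (w t).
Proof. by move=> m0; rewrite /rescale mulrA mulVf ?mul1r// gt_eqF// sqrtr_gt0. Qed.

(** The norm of the difference is a constant times the original one at dilated times, and the time
    dilation preserves the half-line of nonnegative times. *)
Lemma continuous_X_rescale mu e m zeta v : 0 < e -> 0 < m ->
  continuous_X mu zeta v -> continuous_X (mu * m) (rescale e m zeta) (rescale e m v).
Proof.
move=> e0 m0 cX t t0; have sV0 : 0 < (Num.sqrt m)^-1 by rewrite invr_gt0 sqrtr_gt0.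
set s' := (Num.sqrt m)^-1 in sV0.
have st0 : 0 <= s' * t by rewrite mulr_ge0// ltW.
pose F t' := fun u => Xnorm mu (fun X => zeta u X - zeta t' X)
  + Xnormv mu (fun X => v u X - v t' X).
have -> : (fun u => Xnorm (mu * m) (fun X => rescale e m zeta u X - rescale e m zeta t X)
    + Xnormv (mu * m) (fun X => rescale e m v u X - rescale e m v t X)) =
    (fun=> Num.sqrt m / e) \* (F (s' * t) \o *%R s').
  apply/funext => u; rewrite /rescale !rescale_dataB Xnorm_rescale_data//.
  by rewrite Xnormv_rescale_data// -mulrDr.
rewrite -[X in _ --> X](mulr0 (Num.sqrt m / e)); apply: cvgM; first exact: cvg_cst.
apply: cvg_comp (cX _ st0) => A A0.
have cs : ( *%R s' @ t) --> s' * t by apply: cvgMr; exact: cvg_id.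
have sA : \forall x \near t, 0 <= s' * x -> A (s' * x) := cs _ A0.
rewrite /within /=; apply: filterS sA => x Ax x0.
by apply: Ax; rewrite mulr_ge0// ltW.
Qed.

Lemma global_solution_rescale (g a b c d eps mu k e m : R)
    (z0 : plane -> R) (v0 : plane -> plane) zeta v :
  0 < g -> 0 < mu -> 0 < e -> 0 < m ->
  global_solution g a b c d eps mu k z0 v0 zeta v ->
  global_solution g a b c d (eps * e) (mu * m) (k * Num.sqrt m)
    (rescale_data e m z0) (rescale_data e m v0) (rescale e m zeta) (rescale e m v).
Proof.
move=> g0 mu0 e0 m0 [hH1 hX hS h0]; have sV0 : 0 < (Num.sqrt m)^-1 by rewrite invr_gt0 sqrtr_gt0.
split.
- move=> t t0; have [Hz Hv] := hH1 _ (mulr_ge0 (ltW sV0) t0).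
  by split; [apply/H1_rescale_data|apply/H1v_rescale_data].
- exact: continuous_X_rescale.
- by move=> t t0; apply: bfd_system_rescale => //; apply: hS; rewrite mulr_gt0.
- apply: ae_dil sV0 _ h0 => X [zE vE].
  by rewrite /rescale mulr0 /rescale_data; split; congr (_ *: _).
Qed.

(** The converse is the forward direction with [e^-1] and [m^-1], which is why that direction is
    stated for general parameters. *)
Lemma global_solution_rescale_iff (g a b c d eps mu k e m : R)
    (z0 : plane -> R) (v0 : plane -> plane) zeta v :
  0 < g -> 0 < mu -> 0 < e -> 0 < m ->
  global_solution g a b c d (eps * e) (mu * m) (k * Num.sqrt m)
    (rescale_data e m z0) (rescale_data e m v0) (rescale e m zeta) (rescale e m v)
  <-> global_solution g a b c d eps mu k z0 v0 zeta v.
Proof.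
move=> g0 mu0 e0 m0; split; last exact: global_solution_rescale.
have eV0 : 0 < e^-1 by rewrite invr_gt0.
have mV0 : 0 < m^-1 by rewrite invr_gt0.
have mm0 : 0 < mu * m by rewrite mulr_gt0.
move=> /(global_solution_rescale g0 mm0 eV0 mV0).
have s0 : 0 < Num.sqrt m by rewrite sqrtr_gt0.
have -> : eps * e * e^-1 = eps by rewrite mulfK ?gt_eqF.
have -> : mu * m * m^-1 = mu by rewrite mulfK ?gt_eqF.
have -> : k * Num.sqrt m * Num.sqrt m^-1 = k by rewrite sqrtrV ?ltW// mulfK ?gt_eqF.
rewrite (rescale_dataK z0 e0 m0) (rescale_dataK v0 e0 m0).
by rewrite (rescaleK zeta e0 m0) (rescaleK v e0 m0).
Qed.

(** Existence is pulled back by the inverse change of variables, uniqueness is pushed forward; [C]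
    is unchanged because both sides of the bound scale by the same factor. *)
Lemma globally_wellposed_rescale (g a b c d eps mu k C e m : R)
    (z0 : plane -> R) (v0 : plane -> plane) :
  0 < g -> 0 < mu -> 0 < e -> 0 < m ->
  globally_wellposed g a b c d (eps * e) (mu * m) (k * Num.sqrt m) C
    (rescale_data e m z0) (rescale_data e m v0) ->
  globally_wellposed g a b c d eps mu k C z0 v0.
Proof.
move=> g0 mu0 e0 m0 [[zeta [v [sol bnd]]] uniq]; split.
  pose zeta1 := rescale e^-1 m^-1 zeta; pose v1 := rescale e^-1 m^-1 v.
  have zE : zeta = rescale e m zeta1 by rewrite rescaleVK.
  have vE : v = rescale e m v1 by rewrite rescaleVK.
  exists zeta1, v1; rewrite zE vE in sol bnd; split.
    exact: (global_solution_rescale_iff _ _ _ _ _ _ _ _ _ _ g0 mu0 e0 m0).1 sol.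
  move=> t t0; have s0 : 0 < Num.sqrt m by rewrite sqrtr_gt0.
  have k0 : 0 < Num.sqrt m / e by rewrite divr_gt0.
  have := bnd (Num.sqrt m * t) (mulr_ge0 (ltW s0) t0).
  rewrite !rescale_scale// !Xnorm_rescale_data// !Xnormv_rescale_data//.
  by rewrite -!mulrDr mulrCA ler_pM2l.
move=> {zeta v sol bnd} zeta v zeta' v' sol sol' t t0.
have s0 : 0 < Num.sqrt m by rewrite sqrtr_gt0.
have st0 : 0 <= Num.sqrt m * t by rewrite mulr_ge0// ltW.
apply: (ae_dil s0 _ (uniq _ _ _ _ (global_solution_rescale g0 mu0 e0 m0 sol)
  (global_solution_rescale g0 mu0 e0 m0 sol') _ st0)) => X.
rewrite !rescale_scale// /rescale_data => -[].
have -> : (Num.sqrt m)^-1 *: dil (Num.sqrt m) X = X by exact: (dilK (lt0r_neq0 s0)).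
have eV0 : e^-1 != 0 by rewrite invr_neq0 ?gt_eqF.
by move=> /(scalerI eV0) -> /(scalerI eV0) ->.
Qed.

End Solutions.

(** * Comparison of the large-data and small-data regimes *)

Section Equivalences.
Context {R : realType}.
Local Notation plane := (@plane R).
Context {g a b c d : R}.
Context (g0 : 0 < g).

Lemma Xnorm_pair_rescale_data mu e m (z : plane -> R) (v : plane -> plane) : 0 < e -> 0 < m ->
  Xnorm (mu * m) (rescale_data e m z) + Xnormv (mu * m) (rescale_data e m v) =
  Num.sqrt m / e * (Xnorm mu z + Xnormv mu v).
Proof. by move=> e0 m0; rewrite Xnorm_rescale_data// Xnormv_rescale_data// mulrDr. Qed.

Lemma Xnorm_ge0 mu (u : plane -> R) : 0 <= Xnorm mu u.
Proof.
rewrite /Xnorm; set A := [set _ | _ in _]%classic.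
have [->|/set0P A0] := eqVneq A set0; first by rewrite inf0.
by apply: lb_le_inf => // _ [h _ <-]; exact: sqrtr_ge0.
Qed.

Lemma Xnorm_pair_ge0 mu (z : plane -> R) (v : plane -> plane) :
  0 <= Xnorm mu z + Xnormv mu v.
Proof. by rewrite addr_ge0 ?Xnorm_ge0// sqrtr_ge0. Qed.

Lemma ler_of_sqr (x y : R) : 0 <= y -> x ^+ 2 <= y ^+ 2 -> x <= y.
Proof.
move=> y0 xy; rewrite (le_trans (ler_norm x))// -(ger0_norm y0).
by rewrite -[`|x|]sqrtr_sqr -[`|y|]sqrtr_sqr ler_wsqrtr.
Qed.

(* eps = mu = delta^2 turns mu_2 into 1. *)
Lemma large_data_modified :
  large_data_global_existence g a b c d -> modified_small_data_global_existence g a b c d.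
Proof.
move=> [C C0 L]; exists C => // K K1; have K0 : 0 < K by exact: lt_le_trans K1.
(* The norm is multiplied by [delta^-1] and [eta <= K * delta], so the new data are bounded by [K],
   which serves as [N]. *)
have [eps0 eps00 H] := L K K K1 K0.
(* Then [delta <= K * eta <= Num.sqrt eps0], that is, [delta ^+ 2 <= eps0]. *)
exists (Num.sqrt eps0 / K); first by rewrite divr_gt0// sqrtr_gt0.
move=> eta delta /andP[eta0 etale] /andP[]; rewrite ler_pdivrMr// => eta_delta delta_eta.
move=> z0 v0 hz hv bnd.
have delta0 : 0 < delta by rewrite -(pmulr_lgt0 _ K0); exact: lt_le_trans eta_delta.
have d20 : 0 < delta ^+ 2 by rewrite exprn_gt0.
have sd2 : Num.sqrt (delta ^+ 2) = delta by rewrite sqrtr_sqr ger0_norm ?ltW.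
apply: (globally_wellposed_rescale (e := delta ^+ 2) (m := delta ^+ 2)) => //.
have -> : delta^-1 * Num.sqrt (delta ^+ 2) = Num.sqrt 1.
  by rewrite sd2 mulVf ?gt_eqF// sqrtr1.
rewrite mul1r; apply: H.
- have delta_le : delta <= Num.sqrt eps0.
    by rewrite (le_trans delta_eta)// mulrC -ler_pdivlMr.
  rewrite d20 /= -(sqr_sqrtr (ltW eps00)) ler_pXn2r// nnegrE ?sqrtr_ge0//.
  exact: ltW.
- by rewrite /sim ler_pdivrMr// ler_peMr ?(ltW d20)//= ler_peMl// ltW.
- by rewrite /sim mulr1 K1 andbT div1r invf_le1.
- exact/H1_rescale_data.
- exact/H1v_rescale_data.
- rewrite -[X in Xnorm X]mul1r -[X in Xnormv X]mul1r Xnorm_pair_rescale_data//.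
  rewrite sd2 expr2 invfM mulrA mulfV ?gt_eqF// mul1r mulrC ler_pdivrMr//.
  by rewrite mulrC (le_trans bnd).
Qed.

(** The norm is multiplied by [eps / Num.sqrt mu], at most [K * Num.sqrt eps], so the new data have
    size at most [K * N * Num.sqrt eps], taken as [eta]; [delta = Num.sqrt (mu / mu2)] lies within a
    factor [K] of [Num.sqrt eps]. *)
Lemma modified_large_data :
  modified_small_data_global_existence g a b c d -> large_data_global_existence g a b c d.
Proof.
move=> [C C0 M]; exists C => // K N K1 N0; have K0 : 0 < K by exact: lt_le_trans K1.
have KN0 : 0 < K * N by rewrite mulr_gt0.
have K2N0 : 0 < K ^+ 2 * N by rewrite mulr_gt0// exprn_gt0.
have NV0 : 0 < N^-1 by rewrite invr_gt0.
(* For [eta = K * N * x], the term [K ^+ 2 * N] gives [eta <= K' * delta], the term [N^-1] gives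
   [delta <= K' * eta], and 1 ensures [1 <= K']. *)
pose K' := 1 + K ^+ 2 * N + N^-1.
have K'1 : 1 <= K' by rewrite /K'; lra.
have K'0 : 0 < K' by exact: lt_le_trans K'1.
have K'N : 1 <= K' * N.
  have : 0 <= K ^+ 2 * N * N by rewrite mulr_ge0 ?(ltW N0) ?(ltW K2N0).
  by rewrite /K' !mulrDl mulVf ?gt_eqF//; lra.
have [eta0 eta00 H] := M K' K'1.
(* Chosen so that [K * N * Num.sqrt eps <= eta0]. *)
exists ((eta0 / (K * N)) ^+ 2); first by rewrite exprn_gt0// divr_gt0.
move=> eps mu mu2 /andP[eps_gt0 eps_le] /andP[]; rewrite ler_pdivrMr// => eps_mu mu_eps.
move=> /andP[]; rewrite ler_pdivrMr// mulr1 => mu2_ge mu2_le z0 v0 hz hv bnd.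
have mu_gt0 : 0 < mu by rewrite -(pmulr_lgt0 _ K0); exact: lt_le_trans eps_mu.
have mu2_gt0 : 0 < mu2 by rewrite -(pmulr_lgt0 _ K0); exact: lt_le_trans mu2_ge.
have epsV0 : 0 < eps^-1 by rewrite invr_gt0.
have muV0 : 0 < mu^-1 by rewrite invr_gt0.
pose x := Num.sqrt eps; pose y := Num.sqrt mu; pose delta := Num.sqrt (mu / mu2).
have x0 : 0 < x by rewrite sqrtr_gt0.
have y0 : 0 < y by rewrite sqrtr_gt0.
have x2 : x ^+ 2 = eps by rewrite sqr_sqrtr ?ltW.
have y2 : y ^+ 2 = mu by rewrite sqr_sqrtr ?ltW.
have d2 : delta ^+ 2 * mu2 = mu by rewrite sqr_sqrtr ?divr_ge0 ?ltW// divfK// gt_eqF.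
have delta0 : 0 < delta by rewrite sqrtr_gt0 divr_gt0.
have x_Ky : x <= K * y.
  apply: ler_of_sqr; first by rewrite mulr_ge0 ?ltW.
  have : 0 <= mu * K * (K - 1) by rewrite mulr_ge0 ?subr_ge0 ?(mulr_ge0 (ltW mu_gt0) (ltW K0)).
  by rewrite exprMn x2 y2; lra.
have d2_ge0 : 0 <= delta ^+ 2 by exact: sqr_ge0.
have x_Kdelta : x <= K * delta.
  apply: ler_of_sqr; first by rewrite mulr_ge0 ?ltW.
  have : 0 <= delta ^+ 2 * K * (K - mu2) by rewrite mulr_ge0 ?subr_ge0 ?(mulr_ge0 d2_ge0 (ltW K0)).
  by rewrite exprMn x2; move: eps_mu; rewrite -d2; lra.
have delta_Kx : delta <= K * x.
  apply: ler_of_sqr; first by rewrite mulr_ge0 ?ltW.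
  have : 0 <= delta ^+ 2 * (mu2 * K - 1) by rewrite mulr_ge0 ?subr_ge0.
  have : 0 <= K * (K * eps - mu) by rewrite mulr_ge0 ?subr_ge0 ?(ltW K0).
  by rewrite exprMn x2 -d2; lra.
apply: (globally_wellposed_rescale (e := eps^-1) (m := mu^-1)) => //.
rewrite !mulfV ?gt_eqF//.
have -> : Num.sqrt mu2 * Num.sqrt mu^-1 = delta^-1.
  by rewrite -sqrtrM ?ltW// -sqrtrV ?divr_ge0 ?ltW// invf_div.
apply: (H (K * N * x)).
- rewrite mulr_gt0//= mulrC -ler_pdivlMr//; apply: ler_of_sqr; last by rewrite x2.
  by rewrite divr_ge0 ?ltW.
- rewrite /sim ler_pdivrMr//; apply/andP; split.
    apply: le_trans (_ : K ^+ 2 * N * delta <= _).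
      by rewrite expr2 -!mulrA ler_pM2l// mulrCA ler_pM2l.
    by rewrite mulrC ler_pM2l// /K'; lra.
  apply: le_trans delta_Kx _.
  have -> : K' * (K * N * x) = K' * N * (K * x) by ring.
  by rewrite ler_peMl// mulr_ge0 ?ltW.
- exact/H1_rescale_data.
- exact/H1v_rescale_data.
- rewrite -[X in Xnorm X _](mulfV (lt0r_neq0 mu_gt0)) -[X in Xnormv X _](mulfV (lt0r_neq0 mu_gt0)).
  rewrite Xnorm_pair_rescale_data// invrK sqrtrV ?(ltW mu_gt0)// -/y -x2.
  have k_le : y^-1 * x ^+ 2 <= K * x.
    by rewrite ler_pdivrMl// expr2 mulrA ler_pM2r// mulrC.
  rewrite [K * N * x]mulrAC. apply: ler_pM => //; last exact: Xnorm_pair_ge0.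
  by rewrite mulr_ge0 ?sqr_ge0// invr_ge0 ltW.
Qed.

(** With [eps] and [mu] within a factor [K] of 1, the norm factor [eps / Num.sqrt mu] is at most
    [K ^+ 2], while [delta] is unchanged. *)
Lemma modified_small_data :
  modified_small_data_global_existence g a b c d -> small_data_global_existence g a b c d.
Proof.
move=> [C C0 M]; exists C => // K K1; have K0 : 0 < K by exact: lt_le_trans K1.
have K20 : 0 < K ^+ 2 by rewrite exprn_gt0.
(* Data of size [K ^+ 2 * eta] must be comparable to [delta], itself at least [eta / K]; this
   accounts for [K ^+ 3]. *)
have [eta0 eta00 H] := M (K ^+ 3) (exprn_ege1 3 K1).
exists (eta0 / K ^+ 2); first by rewrite divr_gt0.
move=> eta delta eps mu /andP[eta_gt0]; rewrite ler_pdivlMr// mulrC => eta_le.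
move=> /andP[]; rewrite ler_pdivrMr// => eta_delta delta_eta.
move=> /andP[]; rewrite ler_pdivrMr// mulr1 => eps_ge eps_le.
move=> /andP[]; rewrite ler_pdivrMr// mulr1 => mu_ge mu_le z0 v0 hz hv bnd.
have eps_gt0 : 0 < eps by rewrite -(pmulr_lgt0 _ K0); exact: lt_le_trans eps_ge.
have mu_gt0 : 0 < mu by rewrite -(pmulr_lgt0 _ K0); exact: lt_le_trans mu_ge.
have delta0 : 0 < delta by rewrite -(pmulr_lgt0 _ K0); exact: lt_le_trans eta_delta.
have epsV0 : 0 < eps^-1 by rewrite invr_gt0.
have muV0 : 0 < mu^-1 by rewrite invr_gt0.
apply: (globally_wellposed_rescale (e := eps^-1) (m := mu^-1)) => //.
rewrite !mulfV ?gt_eqF//.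
have -> : Num.sqrt (mu / delta ^+ 2) * Num.sqrt mu^-1 = delta^-1.
  rewrite -sqrtrM ?divr_ge0 ?sqr_ge0 ?(ltW mu_gt0)// mulrAC mulfV ?gt_eqF// mul1r.
  by rewrite -exprVn sqrtr_sqr ger0_norm// invr_ge0 ltW.
apply: (H (K ^+ 2 * eta)).
- by rewrite mulr_gt0.
- rewrite /sim ler_pdivrMr ?exprn_gt0//; apply/andP; split.
    have -> : delta * K ^+ 3 = K ^+ 2 * (delta * K) by ring.
    by rewrite ler_pM2l.
  apply: le_trans delta_eta _; have -> : K ^+ 3 * (K ^+ 2 * eta) = K ^+ 4 * (K * eta) by ring.
  by rewrite ler_peMl ?exprn_ege1// mulr_ge0 ?ltW.
- exact/H1_rescale_data.
- exact/H1v_rescale_data.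
- rewrite -[X in Xnorm X _](mulfV (lt0r_neq0 mu_gt0)) -[X in Xnormv X _](mulfV (lt0r_neq0 mu_gt0)).
  rewrite Xnorm_pair_rescale_data// invrK sqrtrV ?(ltW mu_gt0)//.
  have s0 : 0 < Num.sqrt mu by rewrite sqrtr_gt0.
  have sV_le : (Num.sqrt mu)^-1 <= K.
    rewrite -[_^-1]mul1r ler_pdivrMr//; apply: ler_of_sqr; first by rewrite mulr_ge0 ?ltW.
    rewrite exprMn sqr_sqrtr ?(ltW mu_gt0)//.
    have : 0 <= mu * K * (K - 1).
      by rewrite mulr_ge0 ?subr_ge0 ?(mulr_ge0 (ltW mu_gt0) (ltW K0)).
    by move: mu_ge; rewrite expr1n; lra.
  apply: ler_pM => //; last 2 first.
  + exact: Xnorm_pair_ge0.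
  + by rewrite expr2; apply: ler_pM => //; rewrite ?invr_ge0 ltW.
  by rewrite mulr_ge0 ?invr_ge0 ?ltW.
Qed.

(** The modified system is the instance [eps = mu = 1] of the small-data regime. *)
Lemma small_modified_data :
  small_data_global_existence g a b c d -> modified_small_data_global_existence g a b c d.
Proof.
move=> [C C0 S]; exists C => // K K1; have K0 : 0 < K by exact: lt_le_trans K1.
have [eta0 eta00 H] := S K K1; exists eta0 => // eta delta heta hdelta.
have delta0 : 0 < delta.
  move: heta hdelta => /andP[eta_gt0 _] /andP[]; rewrite ler_pdivrMr// => h _.
  by rewrite -(pmulr_lgt0 _ K0); exact: lt_le_trans h.
have sim1 : sim K 1 1 by rewrite /sim mulr1 K1 andbT div1r invf_le1.
have -> : delta^-1 = Num.sqrt (1 / delta ^+ 2).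
  by rewrite div1r -exprVn sqrtr_sqr ger0_norm// invr_ge0 ltW.
by move=> *; apply: (H eta).
Qed.

(** The comparison [delta <= K * eta] turns smallness of [eta] into smallness of [delta], hence the
    threshold [delta0 / K]. *)
Lemma modified_uniform_small_data :
  modified_uniform_small_data_global_existence g a b c d ->
  modified_small_data_global_existence g a b c d.
Proof.
move=> [C [eta0 [delta0 [C0 eta00 delta00 H]]]]; exists C => // K K1.
have K0 : 0 < K by exact: lt_le_trans K1.
exists (Num.min eta0 (delta0 / K)); first by rewrite lt_min eta00 divr_gt0.
move=> eta delta /andP[eta_gt0]; rewrite le_min ler_pdivlMr// => /andP[eta_le eta_delta0].
move=> /andP[]; rewrite ler_pdivrMr// => eta_delta delta_eta z0 v0 hz hv bnd.
apply: H => //; last exact: le_trans eta_le.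
rewrite (le_trans delta_eta) ?[K * _]mulrC// andbT.
by rewrite -(pmulr_lgt0 _ K0); exact: lt_le_trans eta_delta.
Qed.

End Equivalences.

Unset Implicit Arguments.

Theorem corollary1p1 (R : realType) (gamma a b c d : R)
    (hgamma : 0 < gamma < 1) (hb : 0 < b) (hbd : b = d) (ha : a <= 0) (hc : c < 0) :
  [/\ forall (eps mu mu2 delta : R), 0 < eps -> 0 < mu -> 0 < delta ->
        mu2 = mu / delta ^+ 2 ->
        Num.sqrt (mu2 / mu) = delta^-1 /\
        forall (z0 : plane -> R) (v0 : plane -> plane)
               (zeta : R -> plane -> R) (v : R -> plane -> plane),
          global_solution gamma a b c d eps mu (Num.sqrt mu2)
            (rescale_data eps mu z0) (rescale_data eps mu v0)
            (rescale eps mu zeta) (rescale eps mu v)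
          <-> global_solution gamma a b c d 1 1 (Num.sqrt (mu2 / mu)) z0 v0 zeta v,
      forall (eps mu : R), 0 < eps -> 0 < mu ->
        (forall u : plane -> R,
           (H1 (rescale_data eps mu u) <-> H1 u) /\
           (H1 u -> Xnorm mu (rescale_data eps mu u)
                    = Num.sqrt mu / eps * Xnorm 1 u)) /\
        (forall w : plane -> plane,
           (H1v (rescale_data eps mu w) <-> H1v w) /\
           (H1v w -> Xnormv mu (rescale_data eps mu w)
                     = Num.sqrt mu / eps * Xnormv 1 w)),
      large_data_global_existence gamma a b c d
        <-> small_data_global_existence gamma a b c d,
      large_data_global_existence gamma a b c d
        <-> modified_small_data_global_existence gamma a b c d
    & modified_uniform_small_data_global_existence gamma a b c d
        -> large_data_global_existence gamma a b c d].
Proof.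
have g0 : 0 < gamma by case/andP: hgamma.
split.
- move=> eps mu mu2 delta eps0 mu0 delta0 mu2E; split.
    rewrite mu2E mulrAC mulfV ?gt_eqF// mul1r -exprVn sqrtr_sqr ger0_norm//.
    by rewrite invr_ge0 ltW.
  move=> z0 v0 zeta v.
  (* The starting point is the modified system, so the factors [e = eps], [m = mu] are themselves
     the target parameters. *)
  have := global_solution_rescale_iff a b c d 1 (Num.sqrt (mu2 / mu))
    z0 v0 zeta v g0 ltr01 eps0 mu0.
  rewrite !mul1r -sqrtrM ?divfK ?gt_eqF// mu2E.
  by rewrite !divr_ge0 ?sqr_ge0 ?ltW.
- move=> eps mu eps0 mu0; split=> [u|w]; split.
  + exact: H1_rescale_data.
  + by move=> _; rewrite -[X in Xnorm X]mul1r Xnorm_rescale_data.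
  + exact: H1v_rescale_data.
  + by move=> _; rewrite -[X in Xnormv X]mul1r Xnormv_rescale_data.
(* Both directions pass through the modified system. *)
- split=> [/(large_data_modified g0)/(modified_small_data g0)//|].
  by move=> /small_modified_data/(modified_large_data g0).
- by split=> [/(large_data_modified g0)|/(modified_large_data g0)].
- by move=> /modified_uniform_small_data/(modified_large_data g0).
Qed.
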